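(* Let $n\ge 2$, $\mu\in\mathbb R$ with $\mu\neq 0$, and $B\in\mathfrak u(n)$. Let $\mathfrak g=\mathbb R f_1\ltimes\mathbb R^{2n+1}$ be the Lie algebra in which $\mathbb R^{2n+1}=\mathbb Rf_2\oplus\mathbb R^{2n}$ is an abelian ideal and $\operatorname{ad}_{f_1}|_{\mathbb R^{2n+1}}$ has block-diagonal matrix $\operatorname{diag}\big(\mu,\ -\tfrac{\mu}{2n}I_{2n}+B\big)$ with respect to the decomposition $\mathbb Rf_2\oplus\mathbb R^{2n}$. Then the simply connected Lie group $G$ with Lie algebra $\mathfrak g$ admits no lattice.
   Context: $\mathfrak u(n)$ denotes the set of real $2n\times 2n$ matrices $B$ with $B^{T}=-B$ and $BJ_0=J_0B$, where $J_0=\begin{pmatrix}0&-I_n\\ I_n&0\end{pmatrix}$. A lattice in $G$ is a discrete subgroup $\Gamma$ such that $\Gamma\backslash G$ is compact. (These Lie algebras are exactly the non-nilpotent unimodular almost abelian Lie algebras of dimension $2n+2$ carrying an LCK structure.) *)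

(* Defs.v *)
From HB Require Import structures.
From mathcomp Require Import all_boot all_order all_algebra.
From mathcomp Require Import all_classical all_reals all_analysis.
Set Implicit Arguments. Unset Strict Implicit. Unset Printing Implicit Defensive.
Import Order.TTheory GRing.Theory Num.Theory.
Import numFieldNormedType.Exports.
Local Open Scope classical_set_scope.
Local Open Scope ring_scope.

Definition J0 (R : realType) (n : nat) : 'M[R]_(n + n) :=
  block_mx 0 (- 1%:M) 1%:M 0.

Definition in_un (R : realType) (n : nat) (B : 'M[R]_(n + n)) : Prop :=
  B^T = - B /\ B *m J0 R n = J0 R n *m B.

Definition adf1 (R : realType) (n : nat) (mu : R) (B : 'M[R]_(n + n))
  : 'M[R]_(1 + (n + n)) :=
  block_mx (mu%:M : 'M[R]_1) 0 0 ((- (mu / (2 * n)%:R))%:M + B).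

(* phi is the one-parameter group t |-> exp(t A): the (unique) solution of
   phi(0) = I, phi'(t) = A phi(t), stated entrywise. *)
Definition is_exp_flow (R : realType) (m : nat) (A : 'M[R]_m)
  (phi : R -> 'M[R]_m) : Prop :=
  phi 0 = 1%:M /\
  forall (i j : 'I_m) (t : R),
    derivable (fun s => phi s i j) t 1 /\
    derive1 (fun s => phi s i j) t = (A *m phi t) i j.

(* The simply connected almost abelian Lie group G = R |x_phi R^m with
   Lie algebra R f1 |x_A R^m: underlying space R * R^m (column vectors),
   product (t,v)(s,w) = (t+s, v + phi(t) w). *)
Definition sd_mul (R : realType) (m : nat) (phi : R -> 'M[R]_m)
  (x y : R * 'cV[R]_m) : R * 'cV[R]_m :=
  (x.1 + y.1, x.2 + phi x.1 *m y.2).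
Definition sd_one (R : realType) (m : nat) : R * 'cV[R]_m := (0, 0).
Definition sd_inv (R : realType) (m : nat) (phi : R -> 'M[R]_m)
  (x : R * 'cV[R]_m) : R * 'cV[R]_m :=
  (- x.1, - (phi (- x.1) *m x.2)).

(* Gamma is a lattice: a discrete subgroup with compact quotient Gamma\G,
   the latter expressed as G = Gamma K for some compact K. *)
Definition is_lattice (R : realType) (m : nat) (phi : R -> 'M[R]_m)
  (Gam : set (R * 'cV[R]_m)) : Prop :=
  [/\ Gam (sd_one R m),
      (forall x y, Gam x -> Gam y -> Gam (sd_mul phi x y)),
      (forall x, Gam x -> Gam (sd_inv phi x)),
      (exists U, nbhs (sd_one R m) U /\ Gam `&` U = [set sd_one R m]) &
      (exists K, compact K /\
         forall g, exists gam k, Gam gam /\ K k /\ g = sd_mul phi gam k)].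

(* Main.v *)
Require Import Defs.
From HB Require Import structures.
From mathcomp Require Import all_boot all_order all_algebra.
From mathcomp Require Import all_classical all_reals all_analysis.
From mathcomp Require Import complex ring lra zify.
Import Order.TTheory GRing.Theory Num.Theory.
Import numFieldNormedType.Exports.
Local Open Scope classical_set_scope.
Local Open Scope ring_scope.

(** The matrix [phi t] is [diag(lam, Q)] with [lam = exp(mu t)],
    [Q Q^T = s I], [s = exp(- mu t / n)], so [lam = s^-n]: for a solution x of
    [x' = A x], [exp(- mu t) x_0] and the rescaled energy
    [exp(mu t / n) sum_(i > 0) x_i^2] are constant.  In particular [1 - phi t] is
    invertible for [t <> 0], which forces a lattice Gam to meet R^(2n+1) in a
    lattice; hence, for some t with [mu t > 0], both [phi t] and its inverse are
    integer matrices M and M' in a suitable basis.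

    Now s is an eigenvalue of [X |-> M X M^T], and [s^n = 1/lam] is one of M'.  The
    roots of the characteristic polynomial f of the former have modulus [s],
    [lam s^(1/2)] or [lam^2]; the roots z of [g(z) = char_poly(M')(z^n)] have
    modulus [s] or [s^(-1/(2n))].  For n >= 2 only [s] is common, so all roots of
    gcd(f, g), an integer polynomial, have modulus [s < 1], which is absurd.  (For
    n = 1 the moduli [lam s^(1/2)] and [s^(-1/2)] coincide.) *)

(** * Frobenius norms and real similitudes *)

Section Frobenius.
Set Implicit Arguments.
Unset Strict Implicit.
Variable C : numClosedFieldType.

Definition frob p q (X : 'M[C]_(p, q)) : C := \sum_i \sum_j `|X i j| ^+ 2.

Lemma frobE p q (X : 'M[C]_(p, q)) :
  frob X = \tr (X *m (map_mx (@Num.conj C) X)^T).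
Proof.
apply: eq_bigr => i _; rewrite mxE; apply: eq_bigr => j _.
by rewrite !mxE normCK.
Qed.

Lemma frobZ p q (w : C) (X : 'M[C]_(p, q)) : frob (w *: X) = `|w| ^+ 2 * frob X.
Proof.
rewrite /frob mulr_sumr; apply: eq_bigr => i _.
by rewrite mulr_sumr; apply: eq_bigr => j _; rewrite mxE normrM exprMn.
Qed.

Lemma frob_tr p q (X : 'M[C]_(p, q)) : frob X^T = frob X.
Proof.
rewrite /frob exchange_big /=.
by apply: eq_bigr => i _; apply: eq_bigr => j _; rewrite mxE.
Qed.

Lemma frob_neq0 p q (X : 'M[C]_(p, q)) : X != 0 -> frob X != 0.
Proof.
apply: contra => /eqP X0; apply/eqP/matrixP => i j; rewrite mxE.
have ge0 i' j' : 0 <= `|X i' j'| ^+ 2 by rewrite exprn_ge0.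
have := @psumr_eq0P _ _ xpredT (fun i => \sum_j `|X i j| ^+ 2)
  (fun i _ => sumr_ge0 _ (fun j _ => ge0 i j)) X0 i isT.
move/(psumr_eq0P (fun j _ => ge0 i j))/(_ j isT)/eqP.
by rewrite expf_eq0 /= normr_eq0 => /eqP.
Qed.

(** The first hypothesis makes [Q] real, so that its adjoint in [frobE] is its transpose. *)
Lemma frob_mulr p q (X : 'M[C]_(p, q)) (Q : 'M[C]_q) (s : C) :
  map_mx (@Num.conj C) Q = Q -> Q *m Q^T = s%:M -> frob (X *m Q) = s * frob X.
Proof.
move=> Qr QQ; rewrite !frobE map_mxM Qr trmx_mul -mulmxA (mulmxA Q) QQ.
by rewrite mul_scalar_mx -scalemxAr mxtraceZ.
Qed.

Lemma frob_mull p q (X : 'M[C]_(q, p)) (Q : 'M[C]_q) (s : C) :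
  map_mx (@Num.conj C) Q = Q -> Q^T *m Q = s%:M -> frob (Q *m X) = s * frob X.
Proof.
move=> Qr QQ; rewrite -frob_tr trmx_mul (@frob_mulr _ _ _ _ s) ?frob_tr //.
  by rewrite -map_trmx Qr.
by rewrite trmxK.
Qed.

End Frobenius.

Lemma similitude_trmx (F : fieldType) m (s : F) (Q : 'M[F]_m) :
  s != 0 -> Q *m Q^T = s%:M -> Q^T *m Q = s%:M.
Proof.
move=> s0 QQt; have : (s^-1 *: Q) *m Q^T = 1%:M.
  by rewrite -scalemxAl QQt scale_scalar_mx mulVf.
move/mulmx1C; rewrite -scalemxAr => /(congr1 ( *:%R s)).
by rewrite scalerA mulfV // scale1r scale_scalar_mx mulr1.
Qed.
Arguments similitude_trmx {F m s Q}.

(** * Moduli of the eigenvalues attached to diag(lam, Q) *)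

Section ProductSpectrum.
Set Implicit Arguments.
Unset Strict Implicit.
Variables (C : numClosedFieldType) (m : nat) (lam s : C) (Q : 'M[C]_m).
Hypotheses (s_gt0 : 0 < s) (lam_gt0 : 0 < lam).
Hypotheses (Qr : map_mx (@Num.conj C) Q = Q) (QQt : Q *m Q^T = s%:M).

Let P : 'M[C]_(1 + m) := block_mx lam%:M 0 0 Q.

(** The map Y |-> P Y P^T acts on the four blocks of [Y] separately: it multiplies the corner by
    lam^2, [frob] of an off-diagonal block by lam^2 s, and [frob] of the last block by s^2. Any
    nonzero block of an eigenvector thus determines the modulus of [z]. *)
Lemma conj_action_eigenvalue (Y : 'M[C]_(1 + m)) (z : C) :
  Y != 0 -> P *m Y *m P^T = z *: Y ->
  [\/ `|z| = lam ^+ 2, `|z| ^+ 2 = lam ^+ 2 * s | `|z| = s].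
Proof.
move=> Y0; rewrite -[Y]submxK in Y0 *.
move: (ulsubmx Y) (ursubmx Y) (dlsubmx Y) (drsubmx Y) Y0 => a b c d Y0.
rewrite /P tr_block_mx !trmx0 !mulmx_block !mul0mx !mulmx0 !addr0 !add0r.
rewrite scale_block_mx => /eq_block_mx [].
rewrite !tr_scalar_mx !mul_scalar_mx !mul_mx_scalar -!scalemxAl => ea eb ec ed.
have QtQ := similitude_trmx (lt0r_neq0 s_gt0) QQt.
have frobl p (X : 'M[C]_(m, p)) : frob (Q *m X) = s * frob X by exact: frob_mull.
have frobr p (X : 'M[C]_(p, m)) : frob (X *m Q^T) = s * frob X.
  by apply: frob_mulr; rewrite ?trmxK // -map_trmx Qr.
have nz (x : C) : 0 < x -> `|x| ^+ 2 = x ^+ 2 by move=> x0; rewrite gtr0_norm.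
have [d0|d0] := eqVneq d 0; last first.
  constructor 3; apply/eqP; rewrite -(@eqrXn2 _ 2) ?(ltW s_gt0) //.
  rewrite -(inj_eq (@mulIf _ _ (frob_neq0 d0))).
  by rewrite -frobZ -ed frobr frobl mulrA -expr2.
have [c0|c0] := eqVneq c 0; last first.
  constructor 2; apply/eqP; rewrite -(inj_eq (@mulIf _ _ (frob_neq0 c0))).
  by rewrite -frobZ -ec frobZ frobl mulrA nz.
have [b0|b0] := eqVneq b 0; last first.
  constructor 2; apply/eqP; rewrite -(inj_eq (@mulIf _ _ (frob_neq0 b0))).
  by rewrite -frobZ -eb frobZ frobr mulrA nz.
have [a0|a0] := eqVneq a 0; first by rewrite a0 b0 c0 d0 block_mx0 eqxx in Y0.
constructor 1; move: ea; rewrite scalerA => /eqP.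
rewrite -subr_eq0 -scalerBl scaler_eq0 (negPf a0) orbF subr_eq0 => /eqP <-.
by rewrite gtr0_norm ?expr2 // mulr_gt0.
Qed.

(** Here [w] is an eigenvalue of the inverse of [P], expressed without inverting; again a nonzero
    block of [u] decides. *)
Lemma inverse_eigenvalue (u : 'rV[C]_(1 + m)) (w : C) :
  u != 0 -> u = w *: (u *m P) -> w * lam = 1 \/ `|w| ^+ 2 * s = 1.
Proof.
rewrite -[u]hsubmxK; move: (lsubmx u) (rsubmx u) => a b u0.
rewrite /P mul_row_block !mulmx0 addr0 add0r scale_row_mx => /eq_row_mx [ea eb].
have [b0|b0] := eqVneq b 0; last first.
  right; apply/eqP; rewrite -(inj_eq (@mulIf _ _ (frob_neq0 b0))) mul1r {2}eb.
  by rewrite frobZ (@frob_mulr _ _ _ _ _ s) ?mulrA.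
have [a0|a0] := eqVneq a 0; first by rewrite a0 b0 row_mx0 eqxx in u0.
left; move/eqP: ea; rewrite mul_mx_scalar scalerA -{1}[a]scale1r.
by rewrite -subr_eq0 -scalerBl scaler_eq0 (negPf a0) orbF subr_eq0 => /eqP <-.
Qed.

End ProductSpectrum.

(** * Common roots of integer polynomials and the arithmetic contradiction *)

Section CommonRoots.
Set Implicit Arguments.
Unset Strict Implicit.
Variables (C : numClosedFieldType).

(* Otherwise the gcd of f and g, which is integral with leading coefficient +-1 by
   Gauss's lemma, would have a constant coefficient of modulus in (0, 1). *)
Lemma common_roots_not_all_small (f g : {poly int}) (s : C) :
  f \is monic -> 0 < s -> s < 1 ->
  root (map_poly intr f) s -> root (map_poly intr g) s ->
  ~ (forall z : C, root (map_poly intr f) z -> root (map_poly intr g) z ->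
       `|z| = s).
Proof.
move=> fm s0 s1 fs gs small.
(* The rational gcd is a nonzero multiple of an integer polynomial [d] dividing [f] over the
   integers. Gcds survive field extension, so the roots of [d] in [C] are exactly the common
   roots. *)
have /dvdpP_rat_int[d [a a0 da] [r fdr]] :=
  dvdp_gcdl (map_poly intr f : {poly rat}) (map_poly intr g).
have intrE (p : {poly int}) :
    map_poly ratr (map_poly intr p : {poly rat}) = map_poly intr p :> {poly C}.
  by rewrite -map_poly_comp; apply: eq_map_poly => x; rewrite /= ratr_int.
have rootd z : root (map_poly intr d : {poly C}) z =
    root (map_poly intr f) z && root (map_poly intr g) z.
  rewrite -!intrE -root_gcd -gcdp_map da linearZ /= rootZ //.
  by rewrite fmorph_eq0.
have d1 : `|lead_coef d| = 1.
  have : lead_coef d * lead_coef r = 1.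
    by rewrite -lead_coefM -fdr; exact/monicP.
  move=> /(congr1 absz); rewrite abszM => /eqP; rewrite muln_eq1 => /andP[/eqP d1 _].
  by rewrite -abszE d1.
have lead_dC : `|lead_coef (map_poly intr d : {poly C})| = 1.
  by rewrite lead_coef_map_inj ?rmorph0 //; [rewrite normrMz normr1 d1|exact: intr_inj].
have [rs dE] := closed_field_poly_normal (map_poly intr d : {poly C}).
have d0 : map_poly intr d != 0 :> {poly C}.
  by rewrite -lead_coef_eq0 -normr_eq0 lead_dC oner_eq0.
have rsE z : z \in rs -> `|z| = s.
  move=> zrs; have /andP[] : root (map_poly intr f) z && root (map_poly intr g) z.
    rewrite -rootd dE rootZ ?lead_coef_eq0 //.
    by rewrite root_prod_XsubC.
  exact: small.
(* This makes [rs] nonempty, so that the power of [s] below is strictly less than 1. *)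
have srs : s \in rs.
  have : root (map_poly intr d) s by rewrite rootd fs gs.
  by rewrite dE rootZ ?lead_coef_eq0 // root_prod_XsubC.
have : `|(map_poly intr d : {poly C}).[0]| = s ^+ size rs.
  rewrite dE hornerZ normrM lead_dC mul1r horner_prod normr_prod.
  rewrite big_seq (eq_bigr (fun=> s)) => [|z /rsE <-].
    by rewrite -big_seq big_const_seq count_predT iter_mulr_1.
  by rewrite hornerXsubC sub0r normrN.
rewrite horner_coef0 coef_map /= normrMz normr1 => dn.
have : 0 < `|d`_0|%:~R :> C by rewrite dn exprn_gt0.
have : `|d`_0|%:~R < 1 :> C.
  rewrite dn exprn_ilt1 ?ltW //.
  by case: (rs) srs.
rewrite ltr0z -[1]/(1%:~R) ltr_int; lia.
Qed.

Lemma integral_similitude_absurd n m (lam s : C) (Q : 'M[C]_m)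
    (M M' : 'M[int]_(1 + m)) (E : 'M[C]_(1 + m)) :
  (1 < n)%N -> (0 < m)%N -> 0 < s -> s < 1 -> lam * s ^+ n = 1 ->
  map_mx (@Num.conj C) Q = Q -> Q *m Q^T = s%:M -> E \in unitmx ->
  block_mx lam%:M 0 0 Q *m E = E *m map_mx intr M ->
  E = block_mx lam%:M 0 0 Q *m E *m map_mx intr M' -> False.
Proof.
move=> n1 m0 s0 s1 lams Qr QQt Eu; set P := block_mx _ _ _ _ => PE EP.
have n0 : (0 < n)%N by exact: ltnW.
have lam0 : 0 < lam by rewrite -(pmulr_lgt0 _ (exprn_gt0 n s0)) lams.
(* The map X |-> N X N^T, over any ring so that its integral and complex versions can be
   compared. *)
pose T (A : comNzRingType) (N : 'M[A]_(1 + m)) : 'M[A]_(1 + m) -> 'M[A]_(1 + m) :=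
  mulmxr N^T \o mulmx N.
pose f := char_poly (lin_mx (@T _ M)).
pose g := char_poly M' \Po 'X^n.
have fC : map_poly intr f = char_poly (lin_mx (@T C (map_mx intr M))).
  rewrite map_char_poly; congr char_poly; apply: map_lin_mx => X.
  by rewrite /T /= !map_mxM map_trmx.
have gC : map_poly intr g = char_poly (map_mx intr M') \Po 'X^n :> {poly C}.
  by rewrite map_comp_poly map_polyXn map_char_poly.
(* The substitution X |-> E X E^T carries the action of [M] to that of [P]. *)
have conjE X : P *m (E *m X *m E^T) *m P^T =
    E *m T _ (map_mx intr M) X *m E^T.
  by rewrite /T /= !mulmxA PE -!(mulmxA _ E^T) -trmx_mul PE trmx_mul !mulmxA.
have EtU : E^T \in unitmx by rewrite unitmx_tr.
have conjI X Y : E *m X *m E^T = E *m Y *m E^T -> X = Y.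
  move/(can_inj (mulmxK EtU)); exact: (can_inj (mulKmx Eu)).
have rootf z : root (map_poly intr f : {poly C}) z <->
    exists2 Y : 'M[C]_(1 + m), Y != 0 & P *m Y *m P^T = z *: Y.
  rewrite fC -eigenvalue_root_char; split.
    case/eigenvalueP => v vT v0; exists (E *m vec_mx v *m E^T).
      apply: contra v0 => /eqP EvE; rewrite -[v]vec_mxK; apply/eqP.
      have -> : vec_mx v = 0 by apply: conjI; rewrite EvE mulmx0 mul0mx.
      exact: linear0.
    move/(congr1 vec_mx): vT; rewrite mx_rV_lin linearZ /= => vT.
    by rewrite conjE /T /= vT -scalemxAr -scalemxAl.
  case=> Y Y0 PY; apply/eigenvalueP.
  have YE : E *m (invmx E *m Y *m invmx E^T) *m E^T = Y.
    by rewrite !mulmxA mulmxV // mul1mx mulmxKV.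
  exists (mxvec (invmx E *m Y *m invmx E^T)); last first.
    apply: contra Y0 => /eqP/(congr1 vec_mx); rewrite mxvecK linear0 => Z0.
    by rewrite -YE Z0 mulmx0 mul0mx.
  rewrite mul_vec_lin -linearZ; congr mxvec; apply: conjI.
  by rewrite -conjE YE PY -scalemxAr -scalemxAl YE.
have rootg z : root (map_poly intr g : {poly C}) z <->
    exists2 u : 'rV[C]_(1 + m), u != 0 & u = z ^+ n *: (u *m P).
  rewrite gC /root horner_comp hornerXn -/(root _ _) -eigenvalue_root_char.
  have EinvP : map_mx intr M *m invmx E = invmx E *m P.
    by rewrite -[P](mulmxK Eu) PE !mulmxA mulVmx // mul1mx.
  have M'M : map_mx intr M' *m map_mx intr M = 1%:M :> 'M[C]_(1 + m).
    apply: mulmx1C; apply: (can_inj (mulKmx Eu)).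
    by rewrite mulmxA -PE -EP mulmx1.
  split.
    case/eigenvalueP => v vM v0; exists (v *m invmx E).
      apply: contra v0 => /eqP/(congr1 (mulmx^~ E)).
      by rewrite mulmxKV // mul0mx => ->.
    by rewrite scalemxAl scalemxAl -vM -!mulmxA -EinvP (mulmxA _ _ (invmx E)) M'M mul1mx.
  case=> u u0 uP; apply/eigenvalueP; exists (u *m E); last first.
    apply: contra u0 => /eqP/(congr1 (mulmx^~ (invmx E))).
    by rewrite mulmxK // mul0mx => ->.
  by rewrite {2}EP {1}uP -!scalemxAl !mulmxA.
apply: (@common_roots_not_all_small f g s) => //.
- exact: char_poly_monic.
(* The identity in the last block is sent to Q Q^T = s I; [m0] makes it nonzero. *)
- apply/rootf; exists (block_mx 0 0 0 1%:M).
    apply/negP => /eqP/matrixP/(_ (rshift 1 (Ordinal m0)) (rshift 1 (Ordinal m0))).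
    by rewrite block_mxEdr !mxE eqxx => /eqP; rewrite oner_eq0.
  rewrite tr_block_mx !trmx0 !mulmx_block !(mul0mx, mulmx0, addr0, add0r, mulmx1).
  by rewrite QQt scale_block_mx !scaler0 scale_scalar_mx mulr1.
- apply/rootg; exists (row_mx 1%:M 0).
    apply/negP => /eqP/rowP/(_ (lshift m ord0)).
    by rewrite row_mxEl !mxE => /eqP; rewrite oner_eq0.
  rewrite mul_row_block !(mul0mx, mulmx0, addr0, add0r, mul1mx) scale_row_mx.
  by rewrite scaler0 scale_scalar_mx mulrC lams.
move=> z /rootf[Y Y0 PY] /rootg[u u0 uP].
have lamX k : s ^+ (n * k) * lam ^+ k = 1.
  by rewrite exprM -exprMn mulrC lams expr1n.
have sn1 : s != 1 by rewrite lt_eqF.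
(* In the first case |z|^n = 1 / lam = s^n. In the second, |z|^(2n) s = 1 is confronted with each
   modulus allowed by [f], and powers of [lam] are traded for powers of [s] by [lamX]. *)
have [zl|zs] := inverse_eigenvalue Qr QQt u0 uP.
  apply/eqP; rewrite -(@eqrXn2 _ n) ?(ltW s0) // -(inj_eq (mulfI (lt0r_neq0 lam0))).
  by rewrite lams -{1}(gtr0_norm lam0) -normrX -normrM mulrC zl normr1.
case: (conj_action_eigenvalue s0 lam0 Qr QQt Y0 PY) => // zE.
- have : s ^+ (n * (4 * n)) = s ^+ 1.
    rewrite -[LHS]mulr1 -zs normrX zE mulrA expr1.
    have -> : ((lam ^+ 2) ^+ n) ^+ 2 = lam ^+ (4 * n).
      by rewrite -!exprM; congr (_ ^+ _); lia.
    by rewrite lamX mul1r.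
  (* The exponents would satisfy 4 n^2 = 1. *)
  by move/(ieexprIn s0 sn1); nia.
- have : s ^+ (n * (2 * n)) = s ^+ n.+1.
    rewrite -[LHS]mulr1 -zs normrX exprAC zE exprMn -exprM !mulrA lamX mul1r.
    by rewrite exprSr.
  (* The exponents would satisfy 2 n^2 = n + 1, that is (2n + 1)(n - 1) = 0: here n >= 2 is
     decisive. *)
  by move/(ieexprIn s0 sn1); nia.
Qed.
End CommonRoots.

Lemma real_integral_similitude_absurd (R : rcfType) n m (lam s : R) (Q : 'M[R]_m)
    (M M' : 'M[int]_(1 + m)) (E : 'M[R]_(1 + m)) :
  (1 < n)%N -> (0 < m)%N -> 0 < s -> s < 1 -> lam * s ^+ n = 1 ->
  Q *m Q^T = s%:M -> E \in unitmx ->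
  block_mx lam%:M 0 0 Q *m E = E *m map_mx intr M ->
  E = block_mx lam%:M 0 0 Q *m E *m map_mx intr M' -> False.
Proof.
move=> n1 m0 s0 s1 lams QQt Eu PE EP; pose f : {rmorphism R -> complex R} := real_complex R.
have fint p (Z : 'M[int]_p) : map_mx f (map_mx intr Z) = map_mx intr Z.
  by apply/matrixP => i j; rewrite !mxE rmorph_int.
have fP : map_mx f (block_mx (lam%:M : 'M[R]_1) 0 0 Q) =
    block_mx (f lam)%:M 0 0 (map_mx f Q).
  by rewrite map_block_mx !map_mx0 map_scalar_mx.
apply: (@integral_similitude_absurd (complex R) n m (f lam) (f s) (map_mx f Q)
  M M' (map_mx f E)) => //.
- by rewrite ltcR.
- by rewrite ltcR.
- by rewrite -rmorphXn -rmorphM lams rmorph1.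
- apply/matrixP => i j; rewrite !mxE conj_Creal // realE.
  by rewrite -[0]/(f 0) !lecR; exact: le_total.
- by rewrite map_trmx -map_mxM QQt map_scalar_mx.
- by rewrite map_unitmx.
- by rewrite -fP -map_mxM PE map_mxM fint.
- by rewrite -fP -map_mxM -fint -map_mxM -EP.
Qed.

(** * Integral bases of discrete subgroups of R^N *)

Lemma det_replace_col (F : comPzRingType) N (E : 'M[F]_N) (c : 'cV[F]_N) (i : 'I_N) :
  \det (\matrix_(a, b) if b == i then (E *m c) a 0 else E a b) = \det E * c i 0.
Proof.
set E' := \matrix_(a, b) _.
(* Cramer's rule in adjugate form, valid for singular [E] too; the cofactors along column [i] do not
   see the replaced column. *)
have -> : \det E * c i 0 = (\adj E *m (E *m c)) i 0.
  by rewrite mulmxA mul_adj_mx mul_scalar_mx mxE.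
rewrite (expand_det_col _ i) mxE; apply: eq_bigr => a _; rewrite !mxE eqxx mulrC.
congr (_ * _); rewrite /cofactor; congr (_ * \det _).
by apply/matrixP => k l; rewrite !mxE eq_sym (negPf (neq_lift _ _)).
Qed.

Section DiscreteSubgroup.
Set Implicit Arguments.
Unset Strict Implicit.
Variables (R : archiRealFieldType) (N : nat) (L : 'cV[R]_N -> Prop) (eps : R).
Hypotheses (L0 : L 0) (LB : forall x y, L x -> L y -> L (x - y)).
Hypothesis (eps_gt0 : 0 < eps).
Hypothesis Ldiscr : forall v, L v -> (forall i, `|v i 0| < eps) -> v = 0.

Lemma subgroupN x : L x -> L (- x).
Proof. by move=> Lx; rewrite -sub0r; apply: LB. Qed.

Lemma subgroupD x y : L x -> L y -> L (x + y).
Proof. by move=> Lx Ly; rewrite -[y]opprK; apply/LB/subgroupN. Qed.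

Lemma subgroupMz x (z : int) : L x -> L (x *~ z).
Proof.
have Mn n y : L y -> L (y *+ n).
  by move=> Ly; elim: n => [//|n IH]; rewrite mulrS; apply: subgroupD.
by move=> Lx; case: z => n; [apply: Mn|apply/subgroupN/Mn].
Qed.

Lemma subgroup_mulmx p (E : 'M[R]_(N, p)) (z : 'cV[int]_p) :
  (forall j, L (col j E)) -> L (E *m map_mx intr z).
Proof.
move=> LE; have -> : E *m map_mx intr z = \sum_j col j E *~ z j 0.
  apply/colP => i; rewrite summxE mxE; apply: eq_bigr => j _.
  by rewrite -scaler_int !mxE mulrC.
by apply: (big_ind L) => // [|j _]; [exact: subgroupD|exact: subgroupMz].
Qed.

(* Dirichlet's pigeonhole: two of the first q^N + 1 multiples of v have
   coordinates with respect to E falling in the same box of side 1/q modulo 1. *)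
Lemma discrete_finite_index (E : 'M[R]_N) :
  E \in unitmx -> (forall j, L (col j E)) ->
  exists2 k : nat, (0 < k)%N &
    forall v, L v -> exists z : 'cV[int]_N, k%:R *: v = E *m map_mx intr z.
Proof.
move=> Eu LE; pose S := \sum_i \sum_j `|E i j|.
have S0 : 0 <= S by apply: sumr_ge0 => i _; apply: sumr_ge0.
(* With S / q < eps, coordinates of modulus at most 1/q give a vector with entries below [eps]. *)
pose q := Num.bound (S / eps).
have q0 : (0 < q)%N.
  by rewrite -(ltr0n R); apply: le_lt_trans (archi_boundP _); rewrite divr_ge0 ?(ltW eps_gt0).
have Sq : S < eps * q%:R.
  by rewrite mulrC -ltr_pdivrMr // archi_boundP // divr_ge0 ?(ltW eps_gt0).
have small (c : 'cV[R]_N) : (forall i, `|c i 0| <= q%:R^-1) ->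
    forall i, `|(E *m c) i 0| < eps.
  move=> cq i; rewrite mxE; apply: le_lt_trans (ler_norm_sum _ _ _) _.
  apply: (@le_lt_trans _ _ (S / q%:R)); last by rewrite ltr_pdivrMr ?ltr0n.
  rewrite /S mulr_suml [leRHS](bigD1 i) //= -[leLHS]addr0 lerD //.
    rewrite mulr_suml; apply: ler_sum => j _.
    by rewrite normrM ler_wpM2l.
  by apply: sumr_ge0 => j _; rewrite divr_ge0 //; apply: sumr_ge0.
pose K := #|{ffun 'I_N -> 'I_q}|.
(* The multiplier j' - j found below depends on [v] but is at most [K], so the factorial serves all
   [v] at once. *)
exists (K`!); first exact: fact_gt0.
move=> v Lv; pose x := invmx E *m v.
have vE : v = E *m x by rewrite mulKVmx.
move: x vE => x vE.
pose fr (j : nat) i : R := j%:R * x i 0 - (Num.floor (j%:R * x i 0))%:~R.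
have fr_ge0 j i : 0 <= fr j i by rewrite subr_ge0 floor_le.
have fr_lt1 j i : fr j i < 1.
  by rewrite ltrBlDr addrC; have := floorD1_gt (j%:R * x i 0); rewrite intrD.
have tr_lt j i : (Num.truncn (q%:R * fr j i) < q)%N.
  rewrite truncn_lt_nat ?mulr_ge0 //.
  by rewrite -[ltRHS]mulr1 ltr_pM2l ?ltr0n.
pose F (j : 'I_K.+1) : {ffun 'I_N -> 'I_q} := [ffun i => Ordinal (tr_lt j i)].
have [j [j' [jj' Fjj']]] : exists j j' : 'I_K.+1, (j < j')%N /\ F j = F j'.
  have : ~~ injectiveb F.
    apply/negP => /injectiveP/leq_card; rewrite card_ord.
    by rewrite -/K ltnn.
  case/injectivePn => j [j' nj Fj].
  by case: (ltngtP j j') nj => [lt|gt|/val_inj -> ]; [exists j, j'|exists j', j|rewrite eqxx].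
have ltK : (j' - j <= K)%N by have := ltn_ord j'; lia.
pose z : 'cV[int]_N := \col_i (Num.floor (j'%:R * x i 0) - Num.floor (j%:R * x i 0)).
have wE : (j' - j)%:R *: v - E *m map_mx intr z = E *m (\col_i (fr j' i - fr j i)).
  rewrite vE scalemxAr -mulmxBr; congr (_ *m _); apply/colP => i; rewrite !mxE.
  by rewrite natrB ?(ltnW jj') // intrD mulrNz /fr; ring.
(* This element of [L] has coordinates of modulus at most 1/q, hence vanishes by discreteness. *)
have w0 : (j' - j)%:R *: v - E *m map_mx intr z = 0.
  apply: Ldiscr => [|i].
    apply: LB; last exact: subgroup_mulmx.
    by rewrite scaler_nat -[_ *+ _]/(_ *~ Posz _); apply: subgroupMz.
  rewrite wE; apply: small => a; rewrite mxE.
  have := congr1 (fun G : {ffun 'I_N -> 'I_q} => nat_of_ord (G a)) Fjj'.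
  rewrite !ffunE /= => tE.
  have /andP[l1 u1] := truncn_itv (mulr_ge0 (ler0n R q) (fr_ge0 j a)).
  have /andP[l2 u2] := truncn_itv (mulr_ge0 (ler0n R q) (fr_ge0 j' a)).
  rewrite -[leRHS]mul1r ler_pdivlMr ?ltr0n // -{1}(ger0_norm (ler0n R q)).
  rewrite -normrM mulrC mulrBr ler_norml.
  by rewrite -tE -natr1 in l2 u2; rewrite -natr1 in u1; lra.
have /dvdnP[e eK] : (j' - j %| K`!)%N by rewrite dvdn_fact // subn_gt0 jj' ltK.
exists (z *+ e); rewrite eK natrM -scalerA.
by rewrite (subr0_eq w0) scaler_nat !raddfMn.
Qed.

(* A basis is reached by minimising |det E|, a multiple of |det E0| / k^N: a
   vector with a non-integral coordinate c could replace a column of E, which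
   multiplies the determinant by the fractional part of c. *)
Lemma discrete_basis (E0 : 'M[R]_N) :
  E0 \in unitmx -> (forall j, L (col j E0)) ->
  exists E : 'M[R]_N, [/\ E \in unitmx, forall j, L (col j E) &
    forall v, L v -> exists z : 'cV[int]_N, v = E *m map_mx intr z].
Proof.
move=> E0u LE0; have [k k0 Lk] := discrete_finite_index E0u LE0.
(* Since k E = E0 Z with [Z] integral, |det Z| is a natural number measuring |det E|; the descent
   below is on it. *)
have detn (E : 'M[R]_N) : (forall j, L (col j E)) ->
    exists d : nat, `|\det E| * k%:R ^+ N = `|\det E0| * d%:R.
  move=> LE; have [z zE] := choice (fun j => Lk _ (LE j)).
  pose Z : 'M[int]_N := \matrix_(i, j) z j i 0.
  have kE : k%:R *: E = E0 *m map_mx intr Z.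
    apply/matrixP => i j; have /colP/(_ i) := zE j.
    rewrite !mxE => ->; apply: eq_bigr => a _.
    by rewrite !mxE.
  exists `|\det Z|%N; have := congr1 (fun M => `|\det M|) kE.
  rewrite detZ det_mulmx det_map_mx !normrM normrX normr_nat mulrC => ->.
  by rewrite natr_absz intr_norm.
have detE0 : \det E0 != 0 by rewrite -unitfE -unitmxE.
suff step d (E : 'M[R]_N) : E \in unitmx -> (forall j, L (col j E)) ->
    `|\det E| * k%:R ^+ N = `|\det E0| * d%:R ->
    exists E : 'M[R]_N, [/\ E \in unitmx, forall j, L (col j E) &
    forall v, L v -> exists z : 'cV[int]_N, v = E *m map_mx intr z].
  by have [d dE] := detn _ LE0; apply: (step d E0).
have [e] := ubnP d; elim: e d E => // e IH d E de Eu LE dE.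
have [//|nb] := pselect (exists E : 'M[R]_N, [/\ E \in unitmx, forall j, L (col j E) &
    forall v, L v -> exists z : 'cV[int]_N, v = E *m map_mx intr z]).
have [v Lv nz] : exists2 v, L v & ~ exists z : 'cV[int]_N, v = E *m map_mx intr z.
  apply: contrapT => nv; apply: nb; exists E; split=> // v Lv.
  by apply: contrapT => nz; apply: nv; exists v.
pose c := invmx E *m v.
have [i ci] : exists i, (Num.floor (c i 0))%:~R != c i 0.
  apply: contrapT => ni; apply: nz; exists (\col_i Num.floor (c i 0)).
  rewrite -[v](mulKVmx Eu) -/c; congr (_ *m _); apply/colP => i; rewrite [RHS]mxE [X in X%:~R]mxE.
  by apply/esym/eqP/negPn/negP => ne; apply: ni; exists i.
(* Subtracting an integer multiple of column [i] from [v] stays in [L] and leaves the fractional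
   part as coordinate [i]. *)
pose c' := c - map_mx intr (Num.floor (c i 0) *: delta_mx i 0 : 'cV[int]_N).
pose E' : 'M[R]_N := \matrix_(a, b) if b == i then (E *m c') a 0 else E a b.
have detE' : \det E' = \det E * (c i 0 - (Num.floor (c i 0))%:~R).
  by rewrite det_replace_col !mxE !eqxx mulr1.
have LE' j : L (col j E').
  have [->|ji] := eqVneq j i.
    have -> : col i E' = E *m c' by apply/colP => a; rewrite !mxE eqxx.
    rewrite mulmxBr mulKVmx //; apply: LB => //; exact: subgroup_mulmx.
  have -> : col j E' = col j E by apply/colP => a; rewrite !mxE (negPf ji).
  exact: LE.
have fr0 : 0 < c i 0 - (Num.floor (c i 0))%:~R.
  by rewrite subr_gt0 lt_def eq_sym ci floor_le.
have fr1 : c i 0 - (Num.floor (c i 0))%:~R < 1.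
  by rewrite ltrBlDr addrC; have := floorD1_gt (c i 0); rewrite intrD.
have detE : \det E != 0 by rewrite -unitfE -unitmxE.
have [d' dE'] := detn _ LE'.
apply: (IH d' E') => //; last first.
  by rewrite unitmxE detE' unitfE mulf_neq0 // lt0r_neq0.
suff : (d' < d)%N by lia.
rewrite -(ltr_nat R) -(@ltr_pM2l _ `|\det E0|) ?normr_gt0 // -dE -dE'.
rewrite ltr_pM2r ?exprn_gt0 ?ltr0n // detE' normrM (gtr0_norm fr0).
by rewrite -[ltRHS]mulr1 ltr_pM2l ?normr_gt0.
Qed.

End DiscreteSubgroup.

(** * Structure of the flow: exponential factor and similitude block *)

Lemma gram_eq0 (R : realDomainType) p q (Z : 'M[R]_(p, q)) : Z^T *m Z = 0 -> Z = 0.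
Proof.
move=> ZZ; apply/matrixP => i j; rewrite mxE.
have : (Z^T *m Z) j j = 0 by rewrite ZZ mxE.
rewrite mxE => /psumr_eq0P/(_ i) /=.
rewrite mxE -expr2 => h; apply/eqP; rewrite -sqrf_eq0; apply/eqP/h => // k _.
by rewrite mxE -expr2 sqr_ge0.
Qed.
Arguments gram_eq0 {R p q Z}.

Section Flow.
Set Implicit Arguments.
Unset Strict Implicit.
Variables (R : realType) (n : nat) (mu : R) (B : 'M[R]_(n + n)).
Hypotheses (n_gt0 : (0 < n)%N) (Bskew : B^T = - B).
Let A : 'M[R]_(1 + (n + n)) := adf1 mu B.

(** Any number of columns is allowed, so that the flow, its time shifts, its products with constant
    matrices and their differences are all covered. *)
Definition linear_sol (p : nat) (X : R -> 'M[R]_(1 + (n + n), p)) : Prop :=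
  forall i j (t : R), is_derive t 1 (fun s : R => X s i j) ((A *m X t) i j).

Lemma linear_solB p (X Y : R -> 'M[R]_(1 + (n + n), p)) :
  linear_sol X -> linear_sol Y -> linear_sol (fun s => X s - Y s).
Proof.
move=> hX hY i j t; rewrite mulmxBr !mxE.
have -> : (fun s => (X s - Y s) i j) = (fun s => X s i j) - (fun s => Y s i j).
  by apply/funext => s; rewrite !mxE.
by apply: is_deriveB; [have := hX i j t | have := hY i j t]; rewrite mxE.
Qed.

Lemma linear_sol_mulr p q (X : R -> 'M[R]_(1 + (n + n), p)) (K : 'M[R]_(p, q)) :
  linear_sol X -> linear_sol (fun s => X s *m K).
Proof.
move=> hX i j t; rewrite mulmxA mxE.
have -> : (fun s => (X s *m K) i j) = \sum_k (K k j \*: (fun s => X s i k)).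
  apply/funext => s; rewrite mxE fct_sumE; apply: eq_bigr => k _.
  by rewrite mulrC.
apply: is_derive_eq.
  by apply: is_derive_sum => k; apply: is_deriveZ; apply: hX.
by apply: eq_bigr => k _; rewrite /GRing.scale /= mulrC.
Qed.

Lemma linear_sol_shift p (X : R -> 'M[R]_(1 + (n + n), p)) (c : R) :
  linear_sol X -> linear_sol (fun s => X (s + c)).
Proof.
move=> hX i j t; rewrite -[(A *m _) i j]mulr1.
apply: (@is_derive1_comp _ (fun s => X s i j) (fun s => s + c)); first exact: hX.
by apply: is_derive_eq; rewrite addr0.
Qed.

Lemma is_derive_expMl (c t : R) (f : R -> R) (df : R) :
  is_derive t 1 f df ->
  is_derive t 1 (fun s => expR (c * s) * f s) (expR (c * t) * (c * f t + df)).
Proof.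
move=> hf.
have he : is_derive t 1 (fun s => expR (c * s)) (expR (c * t) * c).
  apply: (@is_derive1_comp _ expR (fun s => c * s)).
  by apply: is_derive_eq; rewrite /= [_ *: _]mulr1.
apply: (is_derive_eq (is_deriveM he hf)).
by rewrite /GRing.scale /=; ring.
Qed.

Lemma linear_sol_top p (X : R -> 'M[R]_(1 + (n + n), p)) t :
  linear_sol X -> usubmx (X t) = expR (mu * t) *: usubmx (X 0).
Proof.
move=> hX; apply/matrixP => i j; rewrite ord1 !mxE.
have : expR (- mu * t) * X t (lshift (n + n) 0) j = expR (- mu * 0) * X 0 (lshift (n + n) 0) j.
  apply: (@is_derive_0_is_cst _ (fun s => expR (- mu * s) * X s (lshift (n + n) 0) j)) => s.
  apply: (is_derive_eq (is_derive_expMl _ (hX (lshift (n + n) 0) j s))).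
  have -> : (A *m X s) (lshift (n + n) 0) j = mu * X s (lshift (n + n) 0) j.
    rewrite -[X s]vsubmxK /A /adf1 mul_block_col mul0mx addr0 !col_mxEu.
    by rewrite mul_scalar_mx mxE.
  ring.
rewrite mulr0 expR0 mul1r => <-; rewrite mulrA -expRD.
by rewrite (_ : mu * t + _ = 0) ?expR0 ?mul1r //; ring.
Qed.

(** Polarised form of the energy: in the derivative of X^T Y the contributions of the skew matrix
    [B] cancel, and the two scalar parts -mu/(2n) add up to -mu/n. *)
Lemma linear_sol_bot p q (X : R -> 'M[R]_(1 + (n + n), p))
    (Y : R -> 'M[R]_(1 + (n + n), q)) t :
  linear_sol X -> linear_sol Y ->
  (dsubmx (X t))^T *m dsubmx (Y t) =
  expR (- (mu / n%:R) * t) *: ((dsubmx (X 0))^T *m dsubmx (Y 0)).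
Proof.
move=> hX hY; apply/matrixP => i j; rewrite [RHS]mxE.
pose G s := ((dsubmx (X s))^T *m dsubmx (Y s)) i j.
rewrite -[LHS]/(G t) -/(G 0).
have : expR (mu / n%:R * t) * G t = expR (mu / n%:R * 0) * G 0.
  apply: (@is_derive_0_is_cst _ (fun s => expR (mu / n%:R * s) * G s)) => s.
  pose l := - (mu / (2 * n)%:R).
  have dA r (Z : 'M[R]_(1 + (n + n), r)) :
      dsubmx (A *m Z) = l *: dsubmx Z + B *m dsubmx Z.
    rewrite -{1}[Z]vsubmxK /A /adf1 mul_block_col col_mxKd mul0mx add0r.
    by rewrite mulmxDl mul_scalar_mx.
  have dG : is_derive s 1 G (((dsubmx (A *m X s))^T *m dsubmx (Y s)
        + (dsubmx (X s))^T *m dsubmx (A *m Y s)) i j).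
    have -> : G = \sum_k ((fun s => X s (rshift 1 k) i) * (fun s => Y s (rshift 1 k) j)).
      apply/funext => u; rewrite /G mxE fct_sumE; apply: eq_bigr => k _.
      by rewrite !mxE.
    apply: is_derive_eq.
      by apply: is_derive_sum => k; apply: is_deriveM; [exact: hX|exact: hY].
    rewrite mxE [X in _ = X + _]mxE [X in _ = _ + X]mxE -big_split.
    apply: eq_bigr => k _ /=.
    have dE r (Z : 'M[R]_(1 + (n + n), r)) c : dsubmx Z k c = Z (rshift 1 k) c.
      by rewrite mxE.
    rewrite ![_^T i k]mxE !dE.
    by rewrite /GRing.scale /= addrC (mulrC (Y s _ j)).
  apply: (is_derive_eq (is_derive_expMl _ dG)).
  rewrite !dA linearD /= linearZ /= trmx_mul Bskew mulmxDl mulmxDr -scalemxAl -scalemxAr.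
  rewrite mulmxN mulNmx mulmxA addrACA addNr addr0 -scalerDl mxE -/(G s).
  rewrite -mulrDl (_ : mu / n%:R + (l + l) = 0) ?mul0r ?mulr0 //.
  rewrite /l natrM.
  have : n%:R != 0 :> R by rewrite pnatr_eq0 -lt0n.
  by move=> n0; field.
rewrite mulr0 expR0 mul1r => <-; rewrite mulrA -expRD.
by rewrite (_ : - (mu / n%:R) * t + _ = 0) ?expR0 ?mul1r //; ring.
Qed.

(** The difference of the solutions has zero top row, and its bottom rows have zero Gram matrix. *)
Lemma linear_sol_uniq p (X Y : R -> 'M[R]_(1 + (n + n), p)) t :
  linear_sol X -> linear_sol Y -> X 0 = Y 0 -> X t = Y t.
Proof.
move=> hX hY XY0; apply: subr0_eq; have hD := linear_solB hX hY.
rewrite -[X t - Y t]vsubmxK (linear_sol_top t hD) XY0 subrr.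
rewrite (_ : dsubmx _ = 0) ?linear0 ?scaler0 ?col_mx0 //.
apply: gram_eq0; rewrite (linear_sol_bot t hD hD) XY0 subrr.
by rewrite [dsubmx 0]linear0 mulmx0 scaler0.
Qed.

Variable phi : R -> 'M[R]_(1 + (n + n)).
Hypothesis phi_flow : is_exp_flow A phi.

Lemma flow0 : phi 0 = 1%:M. Proof. exact: phi_flow.1. Qed.

Lemma flow_sol : linear_sol phi.
Proof.
move=> i j t; have [d dE] := phi_flow.2 i j t.
by apply: DeriveDef => //; rewrite -derive1E.
Qed.

(** Both sides solve the equation in [s] and take the value [phi t] at s = 0. *)
Lemma flowD s t : phi (s + t) = phi s *m phi t.
Proof.
apply: (linear_sol_uniq s (linear_sol_shift t flow_sol) (linear_sol_mulr (phi t) flow_sol)).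
by rewrite add0r flow0 mul1mx.
Qed.

(** The bottom rows of the identity have Gram matrix diag(0, I). By [linear_sol_bot] those of
    [phi t] have a multiple of it, so the lower left block has zero Gram matrix. *)
Lemma flow_gram t :
  (dlsubmx (phi t) = 0) *
  ((drsubmx (phi t))^T *m drsubmx (phi t) = (expR (- (mu / n%:R) * t))%:M).
Proof.
have := linear_sol_bot t flow_sol flow_sol.
rewrite flow0 scalar_mx_block /block_mx col_mxKd -[dsubmx (phi t)]hsubmxK.
rewrite !tr_row_mx !mul_col_row scale_block_mx => /eq_block_mx[ll _ _ ->].
split; last by rewrite trmx1 mulmx1 scale_scalar_mx mulr1.
by apply: gram_eq0; move: ll; rewrite trmx0 mul0mx scaler0.
Qed.

Lemma flow_block t :
  phi t = block_mx (expR (mu * t))%:M 0 0 (drsubmx (phi t)).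
Proof.
rewrite -{1}[phi t]submxK flow_gram /ulsubmx /ursubmx.
rewrite (linear_sol_top t flow_sol) flow0 scalar_mx_block /block_mx col_mxKu.
by rewrite scale_row_mx row_mxKl row_mxKr scaler0 scale_scalar_mx mulr1.
Qed.

Lemma flow_continuous i j : continuous (fun t => phi t i j).
Proof.
move=> t; apply: differentiable_continuous; apply/derivable1_diffP.
exact: (phi_flow.2 i j t).1.
Qed.

End Flow.

(** * A lattice meets the abelian factor in a lattice *)

Section AlmostAbelianLattice.
Set Implicit Arguments.
Unset Strict Implicit.
Variables (R : realType) (N : nat) (phi : R -> 'M[R]_N).
Variable Gam : set (R * 'cV[R]_N).
Hypotheses (phi0 : phi 0 = 1%:M) (phiD : forall s t, phi (s + t) = phi s *m phi t).
Hypothesis phi_cont : forall i j, continuous (fun t => phi t i j).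
Hypothesis phi_hyp : forall t, t != 0 -> 1%:M - phi t \in unitmx.
Hypothesis Gam_lattice : is_lattice phi Gam.

Let L (v : 'cV[R]_N) : Prop := Gam (0, v).

Let phiNV t : phi t *m phi (- t) = 1%:M.
Proof. by rewrite -phiD subrr phi0. Qed.

(** The product (t, a) (t, b)^-1 equals (0, a - b). *)
Lemma lattice_sub_fiber t a b : Gam (t, a) -> Gam (t, b) -> L (a - b).
Proof.
case: Gam_lattice => _ GM GV _ _ Ga Gb; have := GM _ _ Ga (GV _ Gb).
by rewrite /sd_mul /sd_inv /= subrr mulmxN mulmxA phiNV mul1mx.
Qed.

Lemma lattice_conj t v l : Gam (t, v) -> L l -> L (phi t *m l).
Proof.
case: Gam_lattice => _ GM _ _ _ Gv Ll; have := lattice_sub_fiber (GM _ _ Gv Ll).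
by rewrite /= addr0 => /(_ _ Gv); rewrite addrC addKr.
Qed.

(** This vector is the R^N-part of the commutator of the two elements. *)
Lemma lattice_comm t v s w : Gam (t, v) -> Gam (s, w) ->
  L ((1%:M - phi s) *m v - (1%:M - phi t) *m w).
Proof.
case: Gam_lattice => _ GM _ _ _ Gv Gw.
have := GM _ _ Gw Gv; rewrite /sd_mul /= addrC => Gwv.
have := lattice_sub_fiber (GM _ _ Gv Gw) Gwv; rewrite /=.
suff -> : v + phi t *m w - (w + phi s *m v) =
  (1%:M - phi s) *m v - (1%:M - phi t) *m w by [].
rewrite !mulmxBl !mul1mx; move: (phi t *m w) (phi s *m v) => a b.
by apply/matrixP => i j; rewrite !mxE; ring.
Qed.

Lemma lattice_fiber_discrete : exists2 eps : R, 0 < eps &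
  forall v, L v -> (forall i, `|v i 0| < eps) -> v = 0.
Proof.
case: Gam_lattice => _ _ _ [U [/nbhs_ballP[e e0 eU] GU]] _.
exists e => // v Lv small.
have : (Gam `&` U) (0, v).
  split=> //; apply: eU; split; first exact: ballxx.
  split=> // i j; rewrite mxE ord1 /ball /= sub0r normrN; exact: small.
by rewrite GU => -[].
Qed.

Lemma compact_continuous_bounded (T : topologicalType) (K : set T) (F : T -> R) :
  compact K -> continuous F -> exists M, forall k, K k -> `|F k| <= M.
Proof.
move=> cK cF; have : compact (F @` K).
  by apply: continuous_compact => //; apply: continuous_subspaceT.
move/compact_bounded => [M [_ hM]]; exists (M + 1) => k Kk.
by apply: (hM (M + 1)); rewrite ?ltrDl //; exists k.
Qed.

Lemma continuous_flow_action (l : 'rV[R]_N) (u : 'cV[R]_N) :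
  continuous (fun k : R * 'cV[R]_N => (l *m phi (- k.1) *m (k.2 - u)) 0 0).
Proof.
have -> : (fun k : R * 'cV[R]_N => (l *m phi (- k.1) *m (k.2 - u)) 0 0) =
    (fun k => \sum_j (\sum_i l 0 i * phi (- k.1) i j) * (k.2 j 0 - u j 0)).
  by apply/funext => k; rewrite mxE; apply: eq_bigr => j _; rewrite !mxE.
apply: continuous_big => [|j _ k]; first exact: add_continuous.
apply: (@cvgM R).
  apply: continuous_big => [|i _ k']; first exact: add_continuous.
  apply: (@cvgM R); first exact: cvg_cst.
  apply: (@continuous_comp _ _ _ (fun k : R * 'cV[R]_N => - k.1) (fun t => phi t i j)).
    by apply: (@cvgN _ R^o); exact: cvg_fst.
  exact: phi_cont.
apply: (@cvgB _ R^o); last exact: cvg_cst.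
apply: (@continuous_comp _ _ _ snd (fun v : 'cV[R]_N => v j 0)); first exact: cvg_snd.
exact: coord_continuous.
Qed.

(** Otherwise every element of the group would have its time component among those of the compact
    set [K], which are bounded. *)
Lemma lattice_time_neq0 : exists t v, t != 0 /\ Gam (t, v).
Proof.
case: Gam_lattice => _ _ _ _ [K [cK GK]].
have [M hM] : exists M, forall k : R * 'cV[R]_N, K k -> `|k.1| <= M.
  by apply: compact_continuous_bounded => // k; exact: cvg_fst.
apply: contrapT => none.
have [[t v] [k [Gtv [Kk]]]] := GK (`|M| + 1, 0).
rewrite /sd_mul /= => -[Mk _].
have t0 : t = 0.
  by apply/eqP/negPn/negP => t0; apply: none; exists t, v.
have := hM _ Kk; rewrite -[k.1]add0r -t0 -Mk; have := ler_norm M.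
have := normr_ge0 M; move: `|M| => m m0 mM.
by rewrite ger0_norm ?addr_ge0 //; lra.
Qed.

(** Rows taken from [L] with maximal rank span it, since appending another element of [L] cannot
    raise the rank. *)
Lemma fiber_span_exists : exists p (A : 'M[R]_(p, N)),
  (forall i, L (row i A)^T) /\ (forall v, L v -> (v^T <= A)%MS).
Proof.
pose P (r : nat) := `[< exists p (A : 'M[R]_(p, N)), (forall i, L (row i A)^T) /\ \rank A = r >].
have exP : exists r, P r.
  exists 0%N; apply/asboolP; exists 0%N, 0; split; first by case.
  exact: mxrank0.
have leP r : P r -> (r <= N)%N.
  by move/asboolP => [p [A [_ <-]]]; exact: rank_leq_col.
case: (ex_maxnP exP leP) => r /asboolP [p [A [LA rA]]] rmax.
exists p, A; split=> // v Lv; have AB : (A <= col_mx A v^T)%MS.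
  by rewrite -addsmxE addsmxSl.
have : (col_mx A v^T <= A)%MS.
  rewrite -(mxrank_leqif_sup AB) eqn_leq mxrankS //= rA; apply: rmax.
  apply/asboolP; exists (p + 1)%N, (col_mx A v^T); split=> // i.
  case: (split_ordP i) => j ->.
    by rewrite rowKu.
  by rewrite rowKd ord1 row_id trmxK.
by rewrite col_mx_sub => /andP[].
Qed.

(* Let u be the fixed point of the affine map x |-> v0 + phi(t0) x given by some
   (t0, v0) in Gam with t0 <> 0.  Commutators with (t0, v0) show that, after
   moving the origin to u, every element of Gam has its R^N-part in the span W of
   the fiber; a functional vanishing on W is then bounded by cocompactness, hence
   zero. *)
Lemma fiber_span_full p (A : 'M[R]_(p, N)) :
  (forall i, L (row i A)^T) -> (forall v, L v -> (v^T <= A)%MS) -> row_full A.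
Proof.
move=> LA AL; rewrite -cokermx_eq0 -trmx_eq0; apply/negPn/negP => /rowV0Pn[l lA l0].
have Al : A *m l^T = 0.
  have /submxP[y ->] := lA; rewrite trmx_mul trmxK.
  by rewrite mulmxA mulmx_coker mul0mx.
have [t0 [v0 [t0_neq0 G0]]] := lattice_time_neq0.
pose D := 1%:M - phi t0; have Du : D \in unitmx by exact: phi_hyp.
have [u Dv] : exists u, v0 = D *m u.
  by exists (invmx D *m v0); rewrite mulKVmx.
(* Conjugation by (t0, v0) preserves the span, and [D] is invertible, so [D] maps the span onto
   itself. *)
have AD : (A <= A *m D^T)%MS.
  have sub : (A *m D^T <= A)%MS.
    rewrite linearB /= trmx1 mulmxBr mulmx1 addmx_sub // eqmx_opp.
    apply/row_subP => i; rewrite row_mul -[row i A]trmxK -trmx_mul.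
    exact/AL/(lattice_conj G0).
  rewrite -(mxrank_leqif_sup sub) mxrankMfree // row_free_unit.
  by rewrite unitmx_tr.
have lW s w : Gam (s, w) -> l *m w = l *m ((1%:M - phi s) *m u).
  move=> Gw; have := lattice_comm G0 Gw; rewrite -/D => LD.
  have {LD} : L (D *m ((1%:M - phi s) *m u - w)).
    rewrite mulmxBr; suff <- : (1%:M - phi s) *m v0 = D *m ((1%:M - phi s) *m u) by [].
    (* [D] commutes with 1 - phi s because the values of [phi] commute. *)
    rewrite Dv !mulmxA; congr (_ *m _); rewrite /D !mulmxBl !mulmxBr.
    rewrite !mul1mx !mulmx1 -!phiD (addrC s); move: (phi _) (phi _) (phi _) => a b c.
    by apply/matrixP => i j; rewrite !mxE; ring.
  move/AL; rewrite trmx_mul => /submx_trans/(_ AD)/submxP[y].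
  rewrite mulmxA => /(can_inj (mulmxK _)) yA.
  have : l *m ((1%:M - phi s) *m u - w) = 0.
    apply: trmx_inj; rewrite trmx_mul yA ?unitmx_tr // -mulmxA Al mulmx0.
    by rewrite trmx0.
  by rewrite mulmxBr => /subr0_eq.
case: Gam_lattice => _ _ _ _ [K [cK GK]].
have [M hM] := compact_continuous_bounded cK (@continuous_flow_action l u).
(* Writing (0, g) = (s, w) k forces s = - k.1, and [lW] eliminates [w]: what remains depends only on
   [k]. *)
have bnd (g : 'cV[R]_N) : `|(l *m g) 0 0| <= `|(l *m u) 0 0| + M.
  have [[s w] [k [Gw [Kk]]]] := GK (0, g); rewrite /sd_mul /= => -[sk ->].
  have sk' : s = - k.1 by apply/eqP; rewrite -addr_eq0 -sk.
  rewrite mulmxDr (lW _ _ Gw) -mulmxDr sk'.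
  have -> : l *m ((1%:M - phi (- k.1)) *m u + phi (- k.1) *m k.2) =
      l *m u + l *m phi (- k.1) *m (k.2 - u).
    rewrite -mulmxA -mulmxDr; congr (_ *m _).
    rewrite mulmxBl mulmxBr mul1mx; move: (phi _ *m u) (phi _ *m _) => a b.
    by apply/matrixP => i j; rewrite !mxE; ring.
  by rewrite mxE; apply: le_trans (ler_normD _ _) _; rewrite lerD2l; apply: hM.
pose q := (l *m l^T) 0 0.
have q0 : 0 < q.
  rewrite /q mxE lt_def sumr_ge0 ?andbT => [|i _]; last first.
    by rewrite mxE -expr2 sqr_ge0.
  apply: contra l0 => /eqP ll; rewrite -trmx_eq0; apply/eqP/gram_eq0.
  by apply/matrixP => i j; rewrite trmxK !ord1 [RHS]mxE -ll mxE.
(* The multiple of [l^T] is scaled so that [l] takes on it the value of the bound plus 1. *)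
have := bnd ((`|(l *m u) 0 0| + M + 1) / q *: l^T).
rewrite -scalemxAr mxE -/q divfK ?gt_eqF //.
by have := ler_norm (`|(l *m u) 0 0| + M + 1); lra.
Qed.

(** Conjugation by an element of [Gam] and by its inverse preserves [L], so both act by integer
    matrices in a basis of [L]. *)
Lemma lattice_integral : exists (t : R) (E : 'M[R]_N) (M M' : 'M[int]_N),
  [/\ t != 0, E \in unitmx, phi t *m E = E *m map_mx intr M &
      phi (- t) *m E = E *m map_mx intr M'].
Proof.
have [eps eps0 Ldiscr] := lattice_fiber_discrete.
have L0 : L 0 by case: Gam_lattice.
have LB x y : L x -> L y -> L (x - y) by exact: lattice_sub_fiber.
have [p [A [LA AL]]] := fiber_span_exists.
have Afull := fiber_span_full LA AL.
have [||E [Eu LE Ebasis]] :=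
    @discrete_basis _ _ L eps L0 LB eps0 Ldiscr (rowsub (fullrankfun Afull) A)^T.
- by rewrite unitmx_tr fullrowsub_unit.
- by move=> j; rewrite -tr_row row_rowsub.
have [t [v [t0 Gt]]] := lattice_time_neq0.
have intM s w : Gam (s, w) -> exists M : 'M[int]_N, phi s *m E = E *m map_mx intr M.
  move=> Gw; have Lz j := Ebasis _ (lattice_conj Gw (LE j)).
  have [z zE] := choice Lz; exists (\matrix_(i, j) z j i 0).
  apply/matrixP => i j; have := zE j.
  rewrite colE mulmxA -colE => /colP/(_ i); rewrite [LHS]mxE => ->.
  by rewrite !mxE; apply: eq_bigr => k _; rewrite !mxE.
have [M tM] := intM _ _ Gt.
have [M' tM'] : exists M' : 'M[int]_N, phi (- t) *m E = E *m map_mx intr M'.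
  case: Gam_lattice => _ _ /(_ _ Gt) GV _ _.
  exact: intM GV.
by exists t, E, M, M'; split.
Qed.

End AlmostAbelianLattice.

(** * Invertibility of 1 - phi t and conclusion *)

Lemma similitude_sub1_unit (R : realFieldType) m (s : R) (Q : 'M[R]_m) :
  s != 1 -> Q *m Q^T = s%:M -> 1%:M - Q \in unitmx.
Proof.
move=> s1 QQt; rewrite -row_free_unit -kermx_eq0; apply/negPn/negP => /rowV0Pn[v].
move/sub_kermxP; rewrite mulmxBr mulmx1 => /subr0_eq vQ /negP; apply.
rewrite -trmx_eq0; apply/eqP/gram_eq0; rewrite trmxK.
(* A fixed vector has its squared length multiplied by [s], which differs from 1. *)
have : v *m v^T = s *: (v *m v^T).
  by rewrite {1 2}vQ trmx_mul -mulmxA (mulmxA Q) QQt mul_scalar_mx -scalemxAr.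
move/eqP; rewrite -{1}[v *m v^T]scale1r -subr_eq0 -scalerBl scaler_eq0 subr_eq0.
by rewrite eq_sym (negPf s1) => /eqP.
Qed.

Theorem theorem3p7 (R : realType) (n : nat) (mu : R) (B : 'M[R]_(n + n))
  (phi : R -> 'M[R]_(1 + (n + n))) :
  (2 <= n)%N -> mu != 0 -> in_un B ->
  is_exp_flow (adf1 mu B) phi ->
  ~ exists Gam : set (R * 'cV[R]_(1 + (n + n))), is_lattice phi Gam.
Proof.
move=> n2 mu0 [Bskew _] flow [Gam lat].
have n0 : (0 < n)%N by exact: ltnW.
have nR0 : n%:R != 0 :> R by rewrite pnatr_eq0 -lt0n.
have phi0 := flow0 flow; have phiD := flowD n0 Bskew flow.
have phiE := flow_block n0 Bskew flow.
have QQt t : drsubmx (phi t) *m (drsubmx (phi t))^T = (expR (- (mu / n%:R) * t))%:M.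
  have := (flow_gram n0 Bskew flow t).2; rewrite -{2}[drsubmx _]trmxK.
  by move/(similitude_trmx (lt0r_neq0 (expR_gt0 _))); rewrite trmxK.
have hyp t : t != 0 -> 1%:M - phi t \in unitmx.
  move=> t0; rewrite phiE scalar_mx_block opp_block_mx add_block_mx !oppr0 !addr0.
  rewrite unitmxE det_ublock unitrM -!unitmxE (similitude_sub1_unit _ (QQt t)) ?andbT.
    rewrite -raddfB /= unitmxE det_scalar1 unitfE subr_eq0 eq_sym -expR0.
    by rewrite (inj_eq (@expR_inj _)) mulf_neq0.
  rewrite -[X in _ != X]expR0 (inj_eq (@expR_inj _)) mulf_neq0 //.
  by rewrite oppr_eq0 mulf_neq0 // invr_eq0.
have [t [E [M [M' [t0 Eu tM tM']]]]] :=
  lattice_integral phi0 phiD (flow_continuous flow) hyp lat.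
have absurd s (S S' : 'M[int]_(1 + (n + n))) : 0 < mu * s ->
    phi s *m E = E *m map_mx intr S -> phi (- s) *m E = E *m map_mx intr S' -> False.
  move=> mus sS sS'.
  apply: (@real_integral_similitude_absurd R n (n + n) (expR (mu * s))
    _ _ S S' E n2 _ _ _ _ (QQt s) Eu).
  - by rewrite addn_gt0 n0.
  - exact: expR_gt0.
  - by rewrite -[X in _ < X]expR0 ltr_expR mulNr oppr_lt0 mulrAC divr_gt0 // ltr0n.
  - by rewrite -expRM_natl -expRD -[RHS]expR0; congr expR; field.
  - by rewrite -phiE; exact: sS.
  - by rewrite -phiE -mulmxA -sS' mulmxA -phiD subrr phi0 mul1mx.
(* If mu t < 0, replacing [t] by [- t] exchanges the roles of [M] and [M']. *)
have : mu * t != 0 by rewrite mulf_neq0.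
rewrite neq_lt => /orP[neg|pos]; last exact: absurd pos tM tM'.
by apply: (absurd (- t) M' M); rewrite ?mulrN ?oppr_gt0 ?opprK.
Qed.
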